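(* Let $F$ be an absolute, normalised norm on $\mathbb{R}^2$ and let $X$ and $Y$ be nontrivial real Banach spaces. Then the following holds: (a) If $r_F=1$ and $X\oplus_F Y$ is LOH, then so is $X$. In particular, if $X\oplus_F Y$ is LOH and $F$ is strictly convex or $F=\|\cdot\|_\infty$, then $X$ is LOH. (b) If $F\neq\|\cdot\|_1$, then $\mathbb{R}\oplus_F Y$ is not LOH. (c) If $r_F>1/2$, then $\ell^\infty\oplus_F Y$, $c_0\oplus_F Y$ and $\ell^\infty(n)\oplus_F Y$ for $n\in\mathbb{N}$ are not LOH. (d) If $r_F>1/\sqrt{2}$ and $H$ is a nontrivial real Hilbert space, then $H\oplus_F Y$ is not LOH.
   Context: All Banach spaces are real; nontrivial means $\neq\{0\}$; $\mathbb{N}=\{1,2,\dots\}$. $S_X$ is the unit sphere of $X$. A norm $F$ on $\mathbb{R}^2$ is absolute if $F(a,b)=F(|a|,|b|)$ for all $(a,b)\in\mathbb{R}^2$, and normalised if $F(1,0)=F(0,1)=1$. For such an absolute, normalised norm $F$ and Banach spaces $X,Y$, the absolute sum $X\oplus_F Y$ is $X\times Y$ with the norm $\|(x,y)\|_F=F(\|x\|,\|y\|)$ (it is a Banach space). $\|\cdot\|_1$ and $\|\cdot\|_\infty$ denote the $1$-norm and the maximum norm on $\mathbb{R}^2$. A norm $F$ on $\mathbb{R}^2$ is strictly convex if $F(u)=F(v)=1$ and $F(u+v)=2$ imply $u=v$ ($u,v\in\mathbb{R}^2$). For an absolute, normalised norm $F$ on $\mathbb{R}^2$ set $$r_F:=\inf\{a\in[0,1]:\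 \exists\, b\geq 0 \text{ with } F(a,b)=1 \text{ and } F(a+1,b)=2\}.$$ A Banach space $X$ is locally octahedral (LOH) if for every $x\in X$ and every $\varepsilon>0$ there exists $y\in S_X$ such that $\|sx+y\|\geq(1-\varepsilon)(|s|\,\|x\|+1)$ for all $s\in\mathbb{R}$. $\ell^\infty$ is the space of bounded real sequences and $c_0$ the space of real null sequences, both with the supremum norm; $\ell^\infty(n)$ is $\mathbb{R}^n$ with the maximum norm. *)

(* Defs.v *)
From HB Require Import structures.
From mathcomp Require Import all_boot all_order all_algebra.
From mathcomp Require Import all_classical all_reals all_analysis.
From mathcomp Require Import ring lra.

Set Implicit Arguments.
Unset Strict Implicit.
Unset Printing Implicit Defensive.

Import Order.TTheory GRing.Theory Num.Theory.
Import numFieldNormedType.Exports.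

Local Open Scope classical_set_scope.
Local Open Scope ring_scope.

Record absnorm (R : realType) := AbsNorm {
  absnorm_fun :> R * R -> R ;
  absnormD : forall u v, absnorm_fun (u + v) <= absnorm_fun u + absnorm_fun v ;
  absnormZ : forall (k : R) (u : R * R),
    absnorm_fun (k * u.1, k * u.2) = `|k| * absnorm_fun u ;
  absnorm_eq0 : forall u, absnorm_fun u = 0 -> u = 0 ;
  absnorm_abs : forall a b, absnorm_fun (a, b) = absnorm_fun (`|a|, `|b|) ;
  absnorm10 : absnorm_fun (1, 0) = 1 ;
  absnorm01 : absnorm_fun (0, 1) = 1 }.

Definition norm1 (R : realType) (u : R * R) : R := `|u.1| + `|u.2|.

Definition norminf (R : realType) (u : R * R) : R := Num.max `|u.1| `|u.2|.

Definition strictly_convex (R : realType) (F : R * R -> R) : Prop :=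
  forall u v, F u = 1 -> F v = 1 -> F (u + v) = 2 -> u = v.

(* For F absolute and normalised, the set contains 1 (take b = 0), so that inf
   does not take its default value on the empty set. *)
Definition r_inf (R : realType) (F : R * R -> R) : R :=
  inf [set a | 0 <= a <= 1 /\
               exists b, [/\ 0 <= b, F (a, b) = 1 & F (a + 1, b) = 2]].

(* An alias of X * Y, because X * Y itself carries the maximum norm. *)
Definition abssum (R : realType) (F : absnorm R)
  (X Y : completeNormedModType R) : Type := (X * Y)%type.

Section absnorm_theory.
Context (R : realType) (F : absnorm R).

Lemma absnorm_ge0 u : 0 <= F u.
Proof.
have F0 : F 0 = 0 by have := absnormZ F 0 0; rewrite /= mulr0 normr0 mul0r.
have FN : F (- u) = F u.
  rewrite -[RHS]mul1r -(normrN1 R) -absnormZ; congr (F _).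
  by rewrite !mulN1r; case: u.
by have := absnormD F u (- u); rewrite subrr F0 FN; lra.
Qed.

Lemma absnorm_x0 a : F (a, 0) = `|a|.
Proof.
have -> : (a, 0 : R) = (a * (1 : R, 0 : R).1, a * (1 : R, 0 : R).2).
  by rewrite /= mulr1 mulr0.
by rewrite absnormZ absnorm10 mulr1.
Qed.

Lemma absnorm_0y b : F (0, b) = `|b|.
Proof.
have -> : (0 : R, b) = (b * (0 : R, 1 : R).1, b * (0 : R, 1 : R).2).
  by rewrite /= mulr1 mulr0.
by rewrite absnormZ absnorm01 mulr1.
Qed.

Lemma absnorm_segment (t : R) (u v w : R * R) : 0 <= t <= 1 ->
  w = (t * u.1 + (1 - t) * v.1, t * u.2 + (1 - t) * v.2) ->
  F w <= t * F u + (1 - t) * F v.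
Proof.
move=> /andP[t0 t1] ->.
have := absnormD F (t * u.1, t * u.2) ((1 - t) * v.1, (1 - t) * v.2).
by rewrite !absnormZ (ger0_norm t0) [`|1 - t|]ger0_norm // subr_ge0.
Qed.

Lemma absnorm_monol a c b : 0 <= a -> a <= c -> F (a, b) <= F (c, b).
Proof.
move=> a0 ac; have [c0|c0] := leP c 0.
  by have -> : a = c by lra.
have t01 : 0 <= (a + c) / (2 * c) <= 1.
  by rewrite divr_ge0 ?ler_pdivrMr//=; lra.
have := @absnorm_segment _ (c, b) (- c, b) (a, b) t01.
have -> : F (- c, b) = F (c, b) by rewrite absnorm_abs normrN -absnorm_abs.
set t := (X in X * F _); have tF x : t * x + (1 - t) * x = x by ring.
rewrite !tF; apply; congr (_, _); rewrite /= ?tF // /t; field.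
by rewrite gt_eqF.
Qed.

Lemma absnorm_monor a b d : 0 <= b -> b <= d -> F (a, b) <= F (a, d).
Proof.
move=> b0 bd; have [d0|d0] := leP d 0.
  by have -> : b = d by lra.
have t01 : 0 <= (b + d) / (2 * d) <= 1.
  by rewrite divr_ge0 ?ler_pdivrMr//=; lra.
have := @absnorm_segment _ (a, d) (a, - d) (a, b) t01.
have -> : F (a, - d) = F (a, d) by rewrite absnorm_abs normrN -absnorm_abs.
set t := (X in X * F _); have tF x : t * x + (1 - t) * x = x by ring.
rewrite !tF; apply; congr (_, _); rewrite /= ?tF // /t; field.
by rewrite gt_eqF.
Qed.

Lemma absnorm_mono a b c d : 0 <= a -> a <= c -> 0 <= b -> b <= d ->
  F (a, b) <= F (c, d).
Proof.
move=> a0 ac b0 bd.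
by apply: le_trans (absnorm_monol b a0 ac) _; exact: absnorm_monor.
Qed.

Lemma absnorm_le_norm1 a b : F (a, b) <= `|a| + `|b|.
Proof.
have := absnormD F (a, 0) (0, b).
by rewrite absnorm_x0 absnorm_0y -[X in F X <= _]/(a + 0, 0 + b) addr0 add0r.
Qed.

End absnorm_theory.

Section abssum_banach.
Context (R : realType) (F : absnorm R) (X Y : completeNormedModType R).

HB.instance Definition _ := GRing.Lmodule.copy (abssum F X Y) (X * Y)%type.

Definition abssum_norm (p : abssum F X Y) : R := F (`|p.1|, `|p.2|).

Let abssum_normD p q : abssum_norm (p + q) <= abssum_norm p + abssum_norm q.
Proof.
rewrite /abssum_norm.
apply: le_trans (absnormD F (`|p.1|, `|p.2|) (`|q.1|, `|q.2|)).
by apply: absnorm_mono => //; exact: ler_normD.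
Qed.

Let abssum_normZ (k : R) p : abssum_norm (k *: p) = `|k| * abssum_norm p.
Proof. by rewrite /abssum_norm /= !normrZ (absnormZ F _ (_, _)) normr_id. Qed.

Let abssum_norm_eq0 p : abssum_norm p = 0 -> p = 0.
Proof.
by case: p => x y /absnorm_eq0[/eqP + /eqP]; rewrite !normr_eq0 => /eqP-> /eqP->.
Qed.

HB.instance Definition _ := Lmodule_isNormed.Build R (abssum F X Y)
  abssum_normD abssum_normZ abssum_norm_eq0.

Lemma abssum_normE (p : abssum F X Y) : `|p| = F (`|p.1|, `|p.2|).
Proof. by []. Qed.

Lemma abssum_norm_fst (p : abssum F X Y) : `|p.1| <= `|p|.
Proof.
rewrite abssum_normE -[leLHS]normr_id -(absnorm_x0 F).
exact: absnorm_mono.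
Qed.

Lemma abssum_norm_snd (p : abssum F X Y) : `|p.2| <= `|p|.
Proof.
rewrite abssum_normE -[leLHS]normr_id -(absnorm_0y F).
exact: absnorm_mono.
Qed.

Lemma abssum_complete (G : set_system (abssum F X Y)) :
  ProperFilter G -> cauchy G -> cvg G.
Proof.
move=> GG /cauchy_ballP Gc.
have cauchyf (Z : completeNormedModType R) (f : abssum F X Y -> Z) :
    (forall p q, `|f p - f q| <= `|p - q|) -> cvg (f @ G).
  move=> fle; apply: cauchy_cvg; apply/cauchy_ballP => e e0.
  rewrite !near_simpl; have := Gc e e0.
  apply: filterS => -[p q] /=.
  by rewrite -!ball_normE /=; exact: le_lt_trans.
have /cvg_ex[/= x xG] : cvg ((fun p : abssum F X Y => p.1) @ G).
  by apply: cauchyf => p q; exact: (abssum_norm_fst (p - q)).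
have /cvg_ex[/= y yG] : cvg ((fun p : abssum F X Y => p.2) @ G).
  by apply: cauchyf => p q; exact: (abssum_norm_snd (p - q)).
apply/cvg_ex; exists ((x, y) : abssum F X Y).
apply/cvgrPdist_le => /= e e0.
have e20 : 0 < e / 2 by rewrite divr_gt0.
near=> p.
rewrite abssum_normE; apply: le_trans (absnorm_le_norm1 _ _ _) _.
rewrite !normr_id [leRHS]splitr lerD//=.
  by near: p; exact: (cvgrPdist_le _ _).1 xG _ e20.
by near: p; exact: (cvgrPdist_le _ _).1 yG _ e20.
Unshelve. all: by end_near. Qed.

HB.instance Definition _ :=
  Uniform_isComplete.Build (abssum F X Y) abssum_complete.

End abssum_banach.

Definition linf_pred (R : realType) : {pred nat -> R^o} :=
  mem [set u : nat -> R^o | bounded_fun u].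
Arguments linf_pred : clear implicits.

Lemma linf_submod_closed (R : realType) : submod_closed (linf_pred R).
Proof.
split.
  rewrite inE /=; exists 0; split; first exact: num_real.
  move=> M M0 n _ /=.
  by rewrite normr0 ltW.
move=> k u v; rewrite !inE /= => -[A [_ uA]] [B [_ vB]].
exists (`|k| * (A + 1) + (B + 1)); split; first exact: num_real.
move=> M MAB n _ /=.
apply: le_trans (ltW MAB).
apply: le_trans (ler_normD _ _) _; apply: lerD.
  rewrite normrM ler_wpM2l// uA//; lra.
by apply: vB => //; lra.
Qed.

HB.instance Definition _ (R : realType) :=
  GRing.isSubmodClosed.Build R (nat -> R^o) (linf_pred R)
    (@linf_submod_closed R).

Record linf (R : realType) := LInf {
  linf_val :> nat -> R^o ;
  linf_valP : linf_val \in linf_pred R }.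

HB.instance Definition _ R := [isSub for @linf_val R].
HB.instance Definition _ R := [Choice of linf R by <:].
HB.instance Definition _ R := [SubChoice_isSubLmodule of linf R by <:].

Section linf_banach.
Context (R : realType).
Implicit Types u v : linf R.

Definition linf_norm u : R := sup (range (fun n => `|u n|)).

Lemma linf_has_sup u : has_sup (range (fun n => `|u n|)).
Proof.
split; first by exists `|u 0%N|; exists 0%N.
case: u => u; rewrite /= inE /= => -[A [_ uA]].
exists (A + 1) => _ [n _ <-]; apply: uA => //.
by rewrite ltrDl.
Qed.

Lemma linf_norm_ub u n : `|u n| <= linf_norm u.
Proof. by apply: sup_upper_bound; [exact: linf_has_sup|exists n]. Qed.

Lemma linf_norm_le u (M : R) : (forall n, `|u n| <= M) -> linf_norm u <= M.
Proof.
move=> uM; apply: ge_sup; first by exists `|u 0%N|; exists 0%N.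
by move=> _ [n _ <-].
Qed.

Let linf_normD u v : linf_norm (u + v) <= linf_norm u + linf_norm v.
Proof.
apply: linf_norm_le => n; apply: le_trans (ler_normD _ _) _.
by rewrite lerD// linf_norm_ub.
Qed.

Let linf_normZ (k : R) u : linf_norm (k *: u) = `|k| * linf_norm u.
Proof.
have le_normZ (l : R) w : linf_norm (l *: w) <= `|l| * linf_norm w.
  by apply: linf_norm_le => n; rewrite normrM ler_wpM2l// linf_norm_ub.
apply/eqP; rewrite eq_le le_normZ /=.
have [->|k0] := eqVneq k 0.
  rewrite normr0 mul0r; exact: le_trans (linf_norm_ub _ 0%N).
have := le_normZ k^-1 (k *: u).
by rewrite scalerA mulVf// scale1r normfV -ler_pdivrMl ?invrK ?invr_gt0 ?normr_gt0.
Qed.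

Let linf_norm_eq0 u : linf_norm u = 0 -> u = 0.
Proof.
move=> u0; apply/val_inj/funext => n; apply/eqP; rewrite -normr_le0 -u0.
exact: linf_norm_ub.
Qed.

HB.instance Definition _ := Lmodule_isNormed.Build R (linf R)
  linf_normD linf_normZ linf_norm_eq0.

Lemma linf_normE u : `|u| = sup (range (fun n => `|u n|)).
Proof. by []. Qed.

Lemma linf_complete (G : set_system (linf R)) :
  ProperFilter G -> cauchy G -> cvg G.
Proof.
move=> GG /cauchy_ballP Gc.
have cvgG n : cvg ((fun u : linf R => u n) @ G).
  apply: cauchy_cvg; apply/cauchy_ballP => e e0.
  rewrite !near_simpl; have := Gc e e0.
  apply: filterS => -[u v] /=.
  rewrite -!ball_normE /=; apply: le_lt_trans.
  exact: (linf_norm_ub (u - v)).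
pose l n : R^o := lim ((fun u : linf R => u n) @ G).
have unif (e : R) : 0 < e -> \forall u \near G, forall n, `|l n - (u : linf R) n| <= e.
  move=> e0; have e20 : 0 < e / 2 by rewrite divr_gt0.
  have [u0 Gu0] : exists u0, G (ball u0 (e / 2)).
    by apply: (cauchyP G).1 e20; exact/cauchy_ballP.
  have lu0 n : `|l n - u0 n| <= e / 2.
    apply: (closed_cvg (fun y : R^o => `|y - u0 n| <= e / 2)) (cvgG n).
      rewrite [X in closed X](_ : _ =
          closed_ball_ Num.norm (u0 n : R^o) (e / 2)).
        exact: closed_closed_ball_.
      by apply/seteqP; split => y /=; rewrite distrC.
    apply: filterS Gu0 => w; rewrite -ball_normE /= distrC => /ltW.
    exact: le_trans (linf_norm_ub (w - u0) n).
  near=> u => n.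
  have u0u : `|u0 n - u n| <= e / 2.
    apply: le_trans (linf_norm_ub (u0 - u) n) _; apply: ltW.
    by near: u; move: Gu0; rewrite -ball_normE.
  rewrite (le_trans (ler_distD (u0 n) _ _))// [leRHS]splitr.
  exact: lerD.
have lb : l \in linf_pred R.
  rewrite inE /=; near G => u.
  have ul : forall n, `|l n - u n| <= 1.
    by near: u; exact: unif.
  exists (1 + `|u|); split; first exact: num_real.
  move=> M uM n _ /=.
  apply: le_trans (ltW uM); rewrite -[l n](subrK (u n)).
  apply: le_trans (ler_normD _ _) _; rewrite lerD//.
  exact: (linf_norm_ub u n).
apply/cvg_ex; exists (LInf lb).
apply/cvgrPdist_le => /= e e0; near=> u.
by apply: linf_norm_le; near: u; exact: unif.
Unshelve. all: by end_near. Qed.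

HB.instance Definition _ := Uniform_isComplete.Build (linf R) linf_complete.

End linf_banach.

Definition c0_pred (R : realType) : {pred linf R} :=
  mem [set u : linf R | (u : nat -> R^o) @ \oo --> (0 : R^o)].
Arguments c0_pred : clear implicits.

Lemma c0_submod_closed (R : realType) : submod_closed (c0_pred R).
Proof.
split; first by rewrite inE /=; exact: cvg_cst.
move=> k u v; rewrite !inE /= => u0 v0.
rewrite -[X in _ --> X](addr0 (0 : R^o)) -[X in _ --> X + _](scaler0 _ k).
by apply: cvgD => //; exact: cvgZl_tmp.
Qed.

HB.instance Definition _ (R : realType) :=
  GRing.isSubmodClosed.Build R (linf R) (c0_pred R) (@c0_submod_closed R).

Record c0 (R : realType) := CZero {
  c0_val :> linf R ;
  c0_valP : c0_val \in c0_pred R }.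

HB.instance Definition _ R := [isSub for @c0_val R].
HB.instance Definition _ R := [Choice of c0 R by <:].
HB.instance Definition _ R := [SubChoice_isSubLmodule of c0 R by <:].

Section c0_banach.
Context (R : realType).
Implicit Types u v : c0 R.

Definition c0_norm u : R := `|c0_val u|.

Let c0_normD u v : c0_norm (u + v) <= c0_norm u + c0_norm v.
Proof. exact: ler_normD. Qed.

Let c0_normZ (k : R) u : c0_norm (k *: u) = `|k| * c0_norm u.
Proof. exact: (normrZ k (c0_val u)). Qed.

Let c0_norm_eq0 u : c0_norm u = 0 -> u = 0.
Proof. by move=> /normr0_eq0 u0; exact: val_inj. Qed.

HB.instance Definition _ := Lmodule_isNormed.Build R (c0 R)
  c0_normD c0_normZ c0_norm_eq0.

Lemma c0_normE u : `|u| = sup (range (fun n => `|u n|)).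
Proof. by []. Qed.

Lemma c0_complete (G : set_system (c0 R)) :
  ProperFilter G -> cauchy G -> cvg G.
Proof.
move=> GG /cauchy_ballP Gc.
have /cvg_ex[/= l lG] : cvg (@c0_val R @ G).
  apply: cauchy_cvg; apply/cauchy_ballP => e e0.
  by rewrite !near_simpl; exact: Gc e e0.
have l0 : l \in c0_pred R.
  rewrite inE /=; apply/cvgrPdist_le => /= e e0.
  have e20 : 0 < e / 2 by rewrite divr_gt0.
  near G => u.
  have lu : `|l - c0_val u| <= e / 2.
    by near: u; exact: (cvgrPdist_le _ _).1 lG _ e20.
  have /set_mem/= u0 := c0_valP u.
  near=> n.
  rewrite (le_trans (ler_distD (u n) _ _))// [leRHS]splitr lerD//.
    by near: n; exact: (cvgrPdist_le _ _).1 u0 _ e20.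
  by rewrite distrC; apply: le_trans lu; exact: (linf_norm_ub (l - c0_val u)).
apply/cvg_ex; exists (CZero l0).
apply/cvgrPdist_le => /= e e0.
exact: (cvgrPdist_le _ _).1 lG _ e0.
Unshelve. all: by end_near. Qed.

HB.instance Definition _ := Uniform_isComplete.Build (c0 R) c0_complete.

End c0_banach.

(* 'rV[R]_n, with its maximum norm, is the Banach space l^oo(n); the library
   does not join its normed and complete structures. *)
HB.instance Definition _ (R : realType) (m n : nat) :=
  Complete.copy 'M[R]_(m, n) 'M[R]_(m, n).

Definition nontrivial (R : realType) (X : completeNormedModType R) : Prop :=
  exists x : X, x != 0.

Definition hilbert (R : realType) (H : completeNormedModType R) : Prop :=
  exists ip : {dot H for (idfun : R -> R)},
    forall x : H, `|x| = Num.sqrt (ip x x).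

Definition locally_octahedral (R : realType) (X : completeNormedModType R) :
    Prop :=
  forall (x : X) (eps : R), 0 < eps ->
    exists y : X, `|y| = 1 /\
      forall s : R, (1 - eps) * (`|s| * `|x| + 1) <= `|s *: x + y|.

(* Main.v *)
Require Import Defs.
From mathcomp Require Import all_boot all_order all_algebra.
From mathcomp Require Import all_classical all_reals all_analysis.
From mathcomp Require Import ring lra.

Import Order.TTheory GRing.Theory Num.Theory.
Import numFieldNormedType.Exports.
Local Open Scope ring_scope.

(** Every part rests on a single criterion: as soon as [F (1, 1) < 2], local
octahedrality passes from the sum of X and Y to its first summand X
([locally_octahedral_fst]). The condition holds in each part: [F (1, 1) = 2]
would make F the 1-norm ([norm1_of_absnorm11]), would put 0 among the numbers
whose infimum is [r_inf F] ([absnorm11_lt2_of_r_inf]), and would make (1, 0)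
and (0, 1) contradict strict convexity, while the maximum norm takes the value 1
at (1, 1).

For the criterion, let x be a unit vector of X and let (u, v) be a witness of
octahedrality at (x, 0) with a small error e. Put a = |u| and b = |v|, so that
F (a, b) = 1 and F (|x + u|, b), F (|x - u|, b) >= 2 - 2 e. The function
t |-> F (t, b) is nondecreasing and 1-Lipschitz, with value 1 at a; to reach
2 - 2 e it needs an argument of at least a + 1 - 2 e. Hence |x + u| and |x - u|
are nearly 1 + a. Moreover 2 - 2 e <= F (1 + a, b) <= F (1, 1) + a keeps a away
from 0, by a bound that depends on F alone, so that u / a is a unit vector with
|x + u / a| and |x - u / a| nearly 2.

The spaces in (b), (c) and (d) have a unit vector x such that
|x + y| + |x - y| <= 3 for all unit vectors y ([nonoctahedral]), which rules out
local octahedrality ([not_locally_octahedral]). With a supremum norm, a coordinate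
vector e is such an x: the coordinate of y at the place of e moves towards 0 in
one of e + y and e - y, which therefore has norm at most 1. In a Hilbert space
the parallelogram law bounds the sum by 2 sqrt 2. *)

(** * Absolute norms and their value at (1, 1) *)

Section AbsoluteNorm.
Context {R : realType} (F : absnorm R).
Implicit Types a b t : R.

Lemma absnorm_lipschitz a b t : a <= t -> F (t, b) <= F (a, b) + (t - a).
Proof.
move=> at_; have := absnormD F (a, b) (t - a, 0).
rewrite absnorm_x0 ger0_norm ?subr_ge0//.
rewrite -[X in F X <= _]/(a + (t - a), b + 0) addr0.
by have -> : a + (t - a) = t by ring.
Qed.

(** The value 2 makes the triangle inequality an equality on the bisector a = b
of the positive quadrant; the Lipschitz bound carries the lower estimate from
there to the rest of the quadrant. *)
Lemma norm1_of_absnorm11 : F (1, 1) = 2 -> F = @norm1 R :> (R * R -> R).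
Proof.
move=> F11; have F_diag c : 0 <= c -> F (c, c) = c + c.
  move=> c0; have := absnormZ F c (1, 1).
  by rewrite /= !mulr1 => ->; rewrite F11 ger0_norm// mulr2n mulrDr mulr1.
apply/funext => -[a b]; rewrite /norm1 /=.
apply/eqP; rewrite eq_le absnorm_le_norm1 /= absnorm_abs.
move: (normr_ge0 a) (normr_ge0 b).
move: `|a| `|b| => {}a {}b a0 b0.
(* Move the smaller coordinate up to the larger one. *)
have [ab|/ltW ba] := leP a b.
  have := absnorm_lipschitz a b b ab; rewrite F_diag//; lra.
have := absnormD F (a, b) (0, a - b).
rewrite absnorm_0y ger0_norm ?subr_ge0//.
rewrite -[X in F X <= _]/(a + 0, b + (a - b)) addr0.
have -> : b + (a - b) = a by ring.
by rewrite F_diag//; lra.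
Qed.

Lemma absnorm11_le2 : F (1, 1) <= 2.
Proof. by have := absnorm_le_norm1 F 1 1; rewrite normr1. Qed.

Lemma absnorm11_lt2 : F (1, 1) <> 2 -> F (1, 1) < 2.
Proof. by move=> /eqP F11; rewrite lt_neqAle F11 absnorm11_le2. Qed.

(** The pair a = 0, b = 1 always satisfies F (a, b) = 1. *)
Lemma absnorm11_lt2_of_r_inf : 0 < r_inf F -> F (1, 1) < 2.
Proof.
move=> r0; apply: absnorm11_lt2 => F11.
suff : r_inf F <= 0 by rewrite leNgt r0.
apply: ge_inf; first by exists 0 => a [/andP[]].
split; first by rewrite lexx ler01.
exists 1; split; [exact: ler01|exact: absnorm01|by rewrite add0r].
Qed.

Lemma absnorm11_lt2_of_strictly_convex : strictly_convex F -> F (1, 1) < 2.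
Proof.
move=> Fconv; apply: absnorm11_lt2 => F11.
have := Fconv (1, 0) (0, 1) (absnorm10 F) (absnorm01 F).
rewrite -[X in F X]/(1 + 0, 0 + 1) addr0 add0r F11 => /(_ erefl) [/eqP].
by rewrite oner_eq0.
Qed.

End AbsoluteNorm.

Lemma norminf11_lt2 (R : realType) : @norminf R (1, 1) < 2.
Proof. by rewrite /norminf /= normr1 maxxx ltr1n. Qed.

(** * Local octahedrality on the unit sphere *)

Section Octahedral.
Context {R : realType} (X : completeNormedModType R).
Implicit Types (x y : X) (s eps : R).

Lemma exists_unit : nontrivial X -> exists x : X, `|x| = 1.
Proof.
move=> [x x0]; exists (`|x|^-1 *: x).
by rewrite normrZ normfV normr_id mulVf ?normr_eq0.
Qed.

(** The vector [s *: x + y] differs from [x + y] by a multiple of x of norm 1 - s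
if s <= 1, and from [s *: (x + y)] by a multiple of y of norm s - 1 if s >= 1; in
both cases the triangle inequality loses only what the error allows. *)
Lemma norm_addZ_ge x y s eps : `|x| = 1 -> `|y| = 1 -> 0 <= eps -> 0 <= s ->
  2 - eps <= `|x + y| -> (1 - eps) * (s + 1) <= `|s *: x + y|.
Proof.
move=> x1 y1 e0 s0 xy; have [s1|/ltW s1] := leP s 1.
  have -> : s *: x + y = (x + y) - (1 - s) *: x.
    by rewrite scalerBl scale1r opprB [RHS]addrC addrA subrK.
  have := lerB_normD (x + y) (- ((1 - s) *: x)).
  rewrite normrN normrZ x1 mulr1 ger0_norm ?subr_ge0//.
  have : 0 <= eps * s by apply: mulr_ge0.
  lra.
have -> : s *: x + y = s *: (x + y) - (s - 1) *: y.
  rewrite scalerDr scalerBl scale1r opprB -addrA; congr (_ + _).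
  by rewrite addrC subrK.
have := lerB_normD (s *: (x + y)) (- ((s - 1) *: y)).
rewrite normrN !normrZ y1 mulr1 (ger0_norm s0) ger0_norm ?subr_ge0//.
have := ler_wpM2l s0 xy.
lra.
Qed.

(** Two inequalities per unit vector suffice, because a witness for x / |x|
also serves x and all its multiples. *)
Lemma locally_octahedral_unit : nontrivial X ->
  (forall x eps, `|x| = 1 -> 0 < eps ->
     exists y, [/\ `|y| = 1, 2 - eps <= `|x + y| & 2 - eps <= `|x - y|]) ->
  locally_octahedral X.
Proof.
move=> /exists_unit[z z1] Xunit x eps e0.
have [->|x0] := eqVneq x 0.
  exists z; split=> // s.
  by rewrite normr0 mulr0 scaler0 !add0r z1; lra.
pose x' := `|x|^-1 *: x.
have x'1 : `|x'| = 1 by rewrite normrZ normfV normr_id mulVf ?normr_eq0.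
have xE : x = `|x| *: x' by rewrite scalerA mulfV ?normr_eq0// scale1r.
have [y [y1 xDy xBy]] := Xunit x' eps x'1 e0.
exists y; split=> // s.
have [s0|/ltW s0] := leP 0 s.
  rewrite {2}xE scalerA (ger0_norm s0).
  by apply: norm_addZ_ge => //; [exact: ltW|exact: mulr_ge0].
have -> : `|s *: x + y| = `|(- s * `|x|) *: x' - y|.
  by rewrite -normrN opprD {1}xE scalerA mulNr scaleNr.
rewrite (ler0_norm s0); apply: norm_addZ_ge; rewrite ?normrN//.
  exact: ltW.
by rewrite mulr_ge0// oppr_ge0.
Qed.

(** Any bound smaller than 4 contradicts local octahedrality; 3 serves both the
supremum norms, where it can be attained, and the Hilbert spaces, where 2 sqrt 2
is an upper bound. *)
Definition nonoctahedral : Prop := exists x : X,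
  `|x| = 1 /\ forall y : X, `|y| = 1 -> `|x + y| + `|x - y| <= 3.

Lemma nonoctahedral_nontrivial : nonoctahedral -> nontrivial X.
Proof.
by move=> [x [x1 _]]; exists x; rewrite -normr_eq0 x1 oner_eq0.
Qed.

Lemma not_locally_octahedral : nonoctahedral -> ~ locally_octahedral X.
Proof.
move=> [x [x1 x3]] Xloh.
have [y [y1 yP]] := Xloh x 8^-1 ltac:(lra).
have := x3 y y1; have := yP 1; have := yP (- 1).
rewrite normrN normr1 x1 scale1r scaleN1r (addrC (- x)) (distrC y); lra.
Qed.

End Octahedral.

(** * Passing to a summand *)

(** If F (1, 1) = 2, the first coordinate u of a witness may vanish, and a
witness then says nothing about X; the gap 2 - F (1, 1) is what keeps u away
from 0. *)
Lemma locally_octahedral_fst (R : realType) (F : absnorm R)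
    (X Y : completeNormedModType R) :
  F (1, 1) < 2 -> nontrivial X ->
  locally_octahedral (abssum F X Y) -> locally_octahedral X.
Proof.
move=> F11 Xnt loh; apply: locally_octahedral_unit => // x eps x1 eps0.
pose d := 2 - F (1, 1).
have d0 : 0 < d by rewrite subr_gt0.
have d1 : d <= 1.
  have := absnorm_monor F 1 (lexx 0) ler01.
  by rewrite absnorm10 /d; lra.
(* With this error, |u| >= d / 2, and dividing by |u| costs at most eps. *)
pose e := Num.min (d / 4) (eps * d / 4).
have e0 : 0 < e.
  by rewrite lt_min !divr_gt0// mulr_gt0.
have ed : e <= d / 4 by rewrite ge_min lexx.
have eeps : e <= eps * d / 4 by rewrite ge_min lexx orbT.
have [[u v] [uv1 uvP]] := loh (x, 0) e e0.
pose a := `|u|; pose b := `|v|.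
have Fab : F (a, b) = 1 by [].
have b0 : 0 <= b by exact: normr_ge0.
have a0 : 0 <= a by exact: normr_ge0.
have a1 : a <= 1 by rewrite -uv1; exact: (abssum_norm_fst ((u, v) : abssum F X Y)).
have b1 : b <= 1 by rewrite -uv1; exact: (abssum_norm_snd ((u, v) : abssum F X Y)).
have x01 : `|(x, 0) : abssum F X Y| = 1.
  by rewrite abssum_normE /= x1 normr0 absnorm10.
have FsP s : `|s| = 1 -> 2 * (1 - e) <= F (`|s *: x + u|, b).
  move=> s1; have := uvP s.
  rewrite s1 x01 abssum_normE /= scaler0 add0r; lra.
have tP t : 0 <= t -> 2 * (1 - e) <= F (t, b) -> 1 + a - 2 * e <= t.
  (* Up to a the function is at most 1, and after a its slope is at most 1. *)
  move=> t0 Ft; rewrite leNgt; apply/negP => ta.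
  have [le_ta|/ltW le_at] := leP t a.
    have := absnorm_monol F b t0 le_ta; rewrite Fab; lra.
  have := absnorm_lipschitz F _ b _ le_at; rewrite Fab; lra.
have xDu : 1 + a - 2 * e <= `|x + u|.
  by apply: tP => //; have := FsP 1 (normr1 _); rewrite scale1r.
have xBu : 1 + a - 2 * e <= `|x - u|.
  apply: tP => //; have := FsP (- 1) (normrN1 _).
  by rewrite scaleN1r (addrC (- x)) distrC.
have ad : d / 2 <= a.
  have F1a : 2 * (1 - e) <= F (1 + a, b).
    apply: le_trans (FsP 1 (normr1 _)) _; rewrite scale1r.
    apply: absnorm_monol => //.
    by apply: le_trans (ler_normD _ _) _; rewrite x1.
  have := absnorm_lipschitz F 1 b (1 + a) ltac:(lra).
  have := absnorm_monor F 1 b0 b1.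
  by rewrite /d in ed *; lra.
have a_gt0 : 0 < a by lra.
have uaP w : `|w| = a -> 1 + a - 2 * e <= `|x + w| ->
    2 - eps <= `|x + a^-1 *: w|.
  move=> wa xw; rewrite -(ler_pM2l a_gt0).
  have -> : a * `|x + a^-1 *: w| = `|(x + w) - (1 - a) *: x|.
    rewrite -{1}(gtr0_norm a_gt0) -normrZ scalerDr scalerA mulfV ?gt_eqF//.
    by rewrite scale1r scalerBl scale1r opprB (addrC (x + w)) addrA subrK.
  have := lerB_normD (x + w) (- ((1 - a) *: x)).
  rewrite normrN normrZ x1 mulr1 ger0_norm ?subr_ge0//.
  have : eps * (d / 2) <= eps * a by rewrite ler_wpM2l// ltW.
  lra.
exists (a^-1 *: u); split.
- by rewrite normrZ gtr0_norm ?invr_gt0// mulVf ?gt_eqF.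
- exact: uaP.
- by rewrite -scalerN; apply: uaP; rewrite ?normrN.
Qed.

Lemma abssum_not_locally_octahedral (R : realType) (F : absnorm R)
    (X Y : completeNormedModType R) :
  F (1, 1) < 2 -> nonoctahedral X -> ~ locally_octahedral (abssum F X Y).
Proof.
move=> F11 Xnon loh; apply: (not_locally_octahedral X Xnon).
by apply: locally_octahedral_fst F11 _ loh; exact: nonoctahedral_nontrivial.
Qed.

(** * Spaces that are not locally octahedral *)

(** A family of coordinates rather than a concrete space, so that the real line,
sequences and row vectors fall under one statement. *)
Lemma sup_norm_nonoctahedral (R : realType)
    (X : completeNormedModType R) (I : eqType) (c : I -> X -> R)
    (i0 : I) (e : X) :
  (forall i x y, c i (x - y) = c i x - c i y) ->
  (forall i x, `|c i x| <= `|x|) ->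
  (forall x M, 0 <= M -> (forall i, `|c i x| <= M) -> `|x| <= M) ->
  (forall i, c i e = (i == i0)%:R) ->
  nonoctahedral X.
Proof.
move=> cB c_le c_sup ce.
have cN i x : c i (- x) = - c i x.
  by rewrite -[- x]sub0r cB -(subrr e) cB subrr sub0r.
have e1 : `|e| = 1.
  apply/eqP; rewrite eq_le; apply/andP; split.
    by apply: c_sup => // i; rewrite ce; case: eqP; rewrite ?normr1 ?normr0.
  by apply: le_trans (c_le i0 e); rewrite ce eqxx normr1.
exists e; split=> // y y1.
(* The sum is symmetric in y and - y, so e - y may be taken as the small term. *)
wlog y0 : y y1 / 0 <= c i0 y.
  move=> ih; have [|y0] := leP 0 (c i0 y); first exact: ih.
  have := ih (- y); rewrite normrN opprK cN oppr_ge0 (addrC `|e - y|).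
  by apply=> //; exact: ltW.
have eBy : `|e - y| <= 1.
  apply: c_sup => // i; rewrite cB ce; have := c_le i y; rewrite y1.
  case: eqP => [->|_]; last by rewrite sub0r normrN.
  by rewrite !ler_norml /= => /andP[_ ?]; apply/andP; split; lra.
have := ler_normD e y; rewrite e1 y1; lra.
Qed.

Lemma real_nonoctahedral (R : realType) :
  nonoctahedral (R^o : completeNormedModType R).
Proof.
apply: (@sup_norm_nonoctahedral R R^o unit (fun=> id) tt 1) => //.
by move=> x M _ /(_ tt).
Qed.

Section Sequences.
Context (R : realType).

Definition delta0 (n : nat) : R^o := (n == 0%N)%:R.

Lemma delta0_bounded : delta0 \in linf_pred R.
Proof.
rewrite inE; exists 1; split; first exact: num_real.
move=> M M1 n _ /=; apply: le_trans (ltW M1).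
by rewrite /delta0; case: eqP; rewrite ?normr1 ?normr0.
Qed.

Lemma delta0_cvg0 : LInf delta0_bounded \in c0_pred R.
Proof.
rewrite inE /=; apply: cvg_near_cst.
by exists 1%N => // n /= n1; rewrite /delta0 gtn_eqF.
Qed.

Lemma linf_nonoctahedral : nonoctahedral (linf R).
Proof.
apply: (@sup_norm_nonoctahedral R (linf R) nat
  (fun n u => u n) 0%N (LInf delta0_bounded)) => //.
- by move=> n u; exact: linf_norm_ub.
- by move=> u M _; exact: linf_norm_le.
Qed.

Lemma c0_nonoctahedral : nonoctahedral (c0 R).
Proof.
apply: (@sup_norm_nonoctahedral R (c0 R) nat
  (fun n u => u n) 0%N (CZero delta0_cvg0)) => //.
- by move=> n u; exact: (linf_norm_ub (c0_val u)).
- by move=> u M _; exact: (@linf_norm_le R (c0_val u)).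
Qed.

End Sequences.

Lemma rV_nonoctahedral (R : realType) (n : nat) : (0 < n)%N ->
  nonoctahedral 'rV[R]_n.
Proof.
case: n => // n _.
apply: (@sup_norm_nonoctahedral R 'rV[R]_n.+1 'I_n.+1
  (fun i x => x ord0 i) ord0 (delta_mx ord0 ord0)).
- by move=> i x y; rewrite !mxE.
- move=> i x; rewrite [leRHS]/Num.norm /= mx_normrE.
  by apply/bigmax_geP; right; exists (ord0, i).
- move=> x M M0 xM; rewrite [leLHS]/Num.norm /= mx_normrE.
  by apply/bigmax_leP; split=> // -[i j] _ /=; rewrite ord1.
- by move=> i; rewrite mxE eqxx.
Qed.

Lemma hilbert_nonoctahedral (R : realType)
    (H : completeNormedModType R) : hilbert H -> nontrivial H ->
  nonoctahedral H.
Proof.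
move=> [ip normE] /exists_unit[x x1].
have ip_ge0 u : 0 <= ip u u.
  have [->|u0] := eqVneq u 0; first by rewrite linear0r.
  exact: ltW (neq0_dnorm_gt0 _ u0).
have sqE u : `|u| ^+ 2 = ip u u by rewrite normE sqr_sqrtr.
exists x; split=> // y y1.
have parallelogram : `|x + y| ^+ 2 + `|x - y| ^+ 2 = 4.
  rewrite !sqE linearBl linearDl !linearB !linearD /= -!sqE x1 y1; ring.
have : 0 <= (`|x + y| - `|x - y|) ^+ 2 by exact: sqr_ge0.
have := normr_ge0 (x + y); have := normr_ge0 (x - y).
nra.
Qed.

Theorem corollary2p8 (R : realType) (F : absnorm R)
    (X Y : completeNormedModType R) :
  nontrivial X -> nontrivial Y ->
  [/\ (r_inf F = 1 -> locally_octahedral (abssum F X Y) ->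
         locally_octahedral X) /\
      (locally_octahedral (abssum F X Y) ->
         strictly_convex F \/ F = @norminf R :> (R * R -> R) ->
         locally_octahedral X),
      F <> @norm1 R :> (R * R -> R) -> ~ locally_octahedral (abssum F R^o Y),
      1 / 2 < r_inf F ->
        [/\ ~ locally_octahedral (abssum F (linf R) Y),
            ~ locally_octahedral (abssum F (c0 R) Y) &
            forall n : nat, (0 < n)%N ->
              ~ locally_octahedral (abssum F 'rV[R]_n Y)] &
      1 / Num.sqrt 2 < r_inf F ->
        forall H : completeNormedModType R, hilbert H -> nontrivial H ->
          ~ locally_octahedral (abssum F H Y)].
Proof.
move=> Xnt Ynt.
split; [split| | |].
- move=> r1; apply: locally_octahedral_fst => //.
  by apply: absnorm11_lt2_of_r_inf; rewrite r1.
- move=> loh FP; apply: locally_octahedral_fst loh => //.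
  case: FP => [|->]; first exact: absnorm11_lt2_of_strictly_convex.
  exact: norminf11_lt2.
- move=> F1; apply: abssum_not_locally_octahedral; last first.
    exact: real_nonoctahedral.
  by apply: absnorm11_lt2 => /norm1_of_absnorm11.
- move=> r12; have F11 : F (1, 1) < 2.
    by apply: absnorm11_lt2_of_r_inf; lra.
  split=> [||n n0]; apply: abssum_not_locally_octahedral => //.
  + exact: linf_nonoctahedral.
  + exact: c0_nonoctahedral.
  + exact: rV_nonoctahedral.
- move=> r12 H Hhilb Hnt; apply: abssum_not_locally_octahedral; last first.
    exact: hilbert_nonoctahedral.
  apply: absnorm11_lt2_of_r_inf; apply: lt_trans r12.
  by rewrite divr_gt0// sqrtr_gt0.
Qed.
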